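(* There exists a function $f(n,w,d)$ such that for every integer $n\geq 3$ and positive integers $w,d$: if $G$ is a connected graph with tree-width at most $w$, $\Delta(G)\leq d$ and $|V(G)|\geq f(n,w,d)$, then $G$ has a connected ring-decomposition of width at most $w$ and length at least $n$.
   Context: All graphs are finite and loopless but may have parallel edges; $[n]=\{1,\dots,n\}$. Tree-width is the minimum, over all tree-decompositions, of the maximum bag size minus one. A ring-decomposition of $G$ of width $w$ (a positive integer) and length $n\geq 3$ is a cyclic sequence $(G_0,G_1,\ldots,G_n)$ of subgraphs of $G$ such that: (R1) $G_0\cup G_1\cup\cdots\cup G_n=G$; (R2) consecutive $G_i$ (cyclically, so $G_n$ and $G_0$ are consecutive) are edge-disjoint and non-consecutive $G_i$ are vertex-disjoint; (R3) for each $i\in[n+1]$, setting $G_{n+1}=G_0$ and $W_i:=V(G_{i-1}\cap G_i)$, we have $|W_i|=w$; (R4) for each $i\in[n]$, $G_i$ contains $w$ vertex-disjoint paths between $W_i$ and $W_{i+1}$. A ring-decomposition is connected if $G_i$ is connected for every $i\in[n]$ ($G_0$ need not be connected). *)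

(* Defs.v *)
From mathcomp Require Import all_boot.
Set Implicit Arguments. Unset Strict Implicit. Unset Printing Implicit Defensive.

(* Finite loopless multigraphs: edges are elements of a finite type, each with
   two distinct endpoints (parallel edges allowed). *)
Record graph := Graph {
  gV : finType;
  gE : finType;
  src : gE -> gV;
  tgt : gE -> gV;
  loopless : forall e, src e != tgt e }.

Definition adj_in (G : graph) (ES : {set gE G}) : rel (gV G) :=
  fun x y => [exists e in ES,
    ((src e == x) && (tgt e == y)) || ((src e == y) && (tgt e == x))].

Definition is_subgraph (G : graph) (VS : {set gV G}) (ES : {set gE G}) : Prop :=
  forall e, e \in ES -> (src e \in VS) && (tgt e \in VS).

Definition connected_sub (G : graph) (VS : {set gV G}) (ES : {set gE G}) : Prop :=
  VS != set0 /\
  forall x y, x \in VS -> y \in VS -> connect (adj_in ES) x y.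

Definition graph_connected (G : graph) : Prop := connected_sub [set: gV G] [set: gE G].

Definition deg (G : graph) (v : gV G) : nat :=
  #|[set e : gE G | (src e == v) || (tgt e == v)]|.

Definition is_tree (k : nat) (tr : rel 'I_k) : Prop :=
  [/\ 0 < k, irreflexive tr, symmetric tr,
      (forall a b, connect tr a b) &
      #|[set p : 'I_k * 'I_k | tr p.1 p.2]| = (k.-1).*2 ].

Definition tree_decomposition (G : graph) (k : nat) (tr : rel 'I_k)
    (bag : 'I_k -> {set gV G}) : Prop :=
  [/\ is_tree tr,
      (forall v, exists t, v \in bag t),
      (forall e, exists t, (src e \in bag t) && (tgt e \in bag t)) &
      (forall v t1 t2, v \in bag t1 -> v \in bag t2 ->
         connect [rel a b | [&& tr a b, v \in bag a & v \in bag b]] t1 t2) ].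

Definition treewidth_le (G : graph) (w : nat) : Prop :=
  exists k (tr : rel 'I_k) (bag : 'I_k -> {set gV G}),
    tree_decomposition tr bag /\ forall t, #|bag t| <= w.+1.

Definition disjoint_paths (G : graph) (VS : {set gV G}) (ES : {set gE G})
    (A B : {set gV G}) (w : nat) : Prop :=
  exists ps : 'I_w -> gV G * seq (gV G),
    (forall k, [/\ (ps k).1 \in A, last (ps k).1 (ps k).2 \in B,
                   path (adj_in ES) (ps k).1 (ps k).2,
                   all (fun v => v \in VS) ((ps k).1 :: (ps k).2) &
                   uniq ((ps k).1 :: (ps k).2)]) /\
    (forall k l, k != l -> forall v,
        v \in (ps k).1 :: (ps k).2 -> v \notin (ps l).1 :: (ps l).2).

Definition consecutive (n i j : nat) : bool :=
  (j == i.+1 %% n.+1) || (i == j.+1 %% n.+1).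

(* W_i = V(G_{i-1} ∩ G_i), for 1 <= i <= n+1, with G_{n+1} = G_0 *)
Definition Wset (G : graph) (n : nat) (GV : nat -> {set gV G}) (i : nat) : {set gV G} :=
  GV i.-1 :&: GV (i %% n.+1).

Definition ring_decomposition (G : graph) (w n : nat)
    (GV : nat -> {set gV G}) (GE : nat -> {set gE G}) : Prop :=
  3 <= n /\ 0 < w /\
  (forall i, i <= n -> is_subgraph (GV i) (GE i)) /\
  (\bigcup_(i < n.+1) GV i) = [set: gV G] /\
  (\bigcup_(i < n.+1) GE i) = [set: gE G] /\
  (forall i j, i <= n -> j <= n -> i != j ->
     (consecutive n i j -> GE i :&: GE j = set0) /\
     (~~ consecutive n i j -> GV i :&: GV j = set0)) /\
  (forall i, 1 <= i <= n.+1 -> #|Wset n GV i| = w) /\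
  (forall i, 1 <= i <= n ->
     disjoint_paths (GV i) (GE i) (Wset n GV i) (Wset n GV i.+1) w).

Definition connected_ring_decomposition (G : graph) (w n : nat)
    (GV : nat -> {set gV G}) (GE : nat -> {set gE G}) : Prop :=
  ring_decomposition w n GV GE /\
  forall i, 1 <= i <= n -> connected_sub (GV i) (GE i).

(* Main.v *)
Require Import Defs.
From Stdlib Require Import Classical.
From mathcomp Require Import all_boot zify.
Set Implicit Arguments. Unset Strict Implicit. Unset Printing Implicit Defensive.

(* A tree-decomposition of width w and bounded degree give, if G is large, a
   long decreasing chain of connected vertex sets C_i whose neighborhoods N(C_i)
   have at most w elements: pass repeatedly to a large component of C_i minus a
   bag that contains N(C_i) and meets C_i. On a long stretch of the chain, let Z
   be the set of the vertices that lie in all N(C_i). After shortening the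
   stretch, the sets S_i = N(C_i) \ Z are pairwise disjoint and Z has no
   neighbors in C_0 \ C_n, so that the pieces S_i + (C_i \ C_(i+1)) form a ring
   which is closed by a piece G_0 containing Z.

   Linkedness and connectivity of the pieces follow by induction on the maximal
   size k of the S_i. If many gaps between C_i and C_(i+1) admit a set X with
   |N(X) \ Z| < k, these X form a nest with a smaller k. Otherwise there is a
   long run of gaps without such an X, in which consecutive S_i are linked by
   Menger's theorem. If a long piece is disconnected, each of its components
   contains one of the linking paths, so that restricting the nest to one
   component decreases k as well. *)

(** * Menger's theorem *)

Section Menger.
Variable T : finType.
Implicit Types (e : rel T) (A B X Y : {set T}).

Definition separates e A B Y :=
  forall a p, a \in A -> path e a p -> last a p \in B -> has (mem Y) (a :: p).

Definition linked e A B k := exists ps : 'I_k -> T * seq T,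
  (forall i, [/\ (ps i).1 \in A, last (ps i).1 (ps i).2 \in B,
     path e (ps i).1 (ps i).2 & uniq ((ps i).1 :: (ps i).2)]) /\
  (forall i j, i != j -> forall v,
     v \in (ps i).1 :: (ps i).2 -> v \notin (ps j).1 :: (ps j).2).

(** Shortening a walk only drops vertices, so disjointness survives; the walks glued together in
    Menger's theorem then need no check for repeated vertices. *)
Lemma linked_shorten e A B k (ps : 'I_k -> T * seq T) :
  (forall i, [/\ (ps i).1 \in A, last (ps i).1 (ps i).2 \in B &
     path e (ps i).1 (ps i).2]) ->
  (forall i j, i != j -> forall v,
     v \in (ps i).1 :: (ps i).2 -> v \notin (ps j).1 :: (ps j).2) ->
  linked e A B k.
Proof.
move=> psP psD.
have subP i : {subset (ps i).1 :: shorten (ps i).1 (ps i).2 <= (ps i).1 :: (ps i).2}.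
  have [_ _ pp] := psP i; case: (shortenP pp) => q _ _ sub v.
  by rewrite !inE => /orP[->//|/sub ->]; rewrite orbT.
exists (fun i => ((ps i).1, shorten (ps i).1 (ps i).2)); split=> [i|i j /psD dij v /=].
  have [aA bB pp] := psP i; move: bB; case: (shortenP pp) => q /= pq uq _ bB.
  by split.
by move=> /subP/dij; apply: contra => /subP.
Qed.

Lemma linked_sub e e' A B k : subrel e e' -> linked e A B k -> linked e' A B k.
Proof.
move=> sub [ps [psP psD]]; exists ps; split=> // i.
by have [? ? pp ?] := psP i; split=> //; apply: sub_path pp.
Qed.

(** Disjoint paths have distinct ends, and k distinct elements exhaust a set of size k. *)
Lemma linked_last B k (ps : 'I_k -> T * seq T) :
  (forall i, last (ps i).1 (ps i).2 \in B) ->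
  (forall i j, i != j -> forall v,
     v \in (ps i).1 :: (ps i).2 -> v \notin (ps j).1 :: (ps j).2) ->
  #|B| = k -> forall b, b \in B -> exists i, last (ps i).1 (ps i).2 = b.
Proof.
move=> psB psD cB b bB.
pose f i := last (ps i).1 (ps i).2.
have injf : injective f.
  move=> i j fij; apply: contraTeq (mem_last (ps i).1 (ps i).2) => ij.
  rewrite -/(f i) fij; apply/negP => /(psD _ _ ij).
  by rewrite mem_last.
have /eqP fB : f @: [set: 'I_k] == B.
  rewrite eqEcard card_imset // cardsT card_ord cB leqnn andbT.
  by apply/subsetP => _ /imsetP[i _ ->]; exact: psB.
by move: bB; rewrite -fB => /imsetP[i _ ->]; exists i.
Qed.

Lemma linked_first A k (ps : 'I_k -> T * seq T) :
  (forall i, (ps i).1 \in A) ->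
  (forall i j, i != j -> forall v,
     v \in (ps i).1 :: (ps i).2 -> v \notin (ps j).1 :: (ps j).2) ->
  #|A| = k -> forall a, a \in A -> exists i, (ps i).1 = a.
Proof.
move=> psA psD cA a aA.
pose f i := (ps i).1.
have injf : injective f.
  move=> i j fij; apply: contraTeq (mem_head (ps i).1 (ps i).2) => ij.
  by apply/negP => /(psD _ _ ij); rewrite -/(f i) fij mem_head.
have /eqP fA : f @: [set: 'I_k] == A.
  rewrite eqEcard card_imset // cardsT card_ord cA leqnn andbT.
  by apply/subsetP => _ /imsetP[i _ ->]; exact: psA.
by move: aA; rewrite -fA => /imsetP[i _ ->]; exists i.
Qed.

(** Menger's theorem is proved for digraphs, so the reverse arc is not deleted along with this
    one. *)
Definition del_edge e x y := [rel a b | e a b && ((a, b) != (x, y))].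

Lemma del_edge_sub e x y : subrel (del_edge e x y) e.
Proof. by move=> a b /= /andP[]. Qed.

Lemma path_del_edge e x y a p :
  path e a p -> y \notin p -> path (del_edge e x y) a p.
Proof.
elim: p a => //= b p IH a /andP[eab pp]; rewrite inE negb_or eq_sym => /andP[yb yp].
by rewrite IH // eab xpair_eqE (negPf yb) andbF.
Qed.

Lemma path_del_edge_src e x y a p :
  path e a p -> x \notin a :: p -> path (del_edge e x y) a p.
Proof.
elim: p a => //= b p IH a /andP[eab pp]; rewrite inE negb_or eq_sym => /andP[xa xp].
by rewrite IH // eab xpair_eqE (negPf xa).
Qed.

(** The path is cut at its first vertex in [X]; as [x] is in [X], no arc leaving [x] has been used
    by then. *)
Lemma prefix_del_edge e x y X a p : x \in X ->
  path e a p -> has (mem X) (a :: p) ->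
  exists q, [/\ path (del_edge e x y) a q, last a q \in X &
                {subset a :: q <= a :: p}].
Proof.
move=> xX; elim: p a => [|b p IH] a /=.
  by rewrite orbF => _ aX; exists [::]; split=> //=.
move=> /andP[eab pp]; have [aX|aX] := boolP (a \in X) => /=.
  by move=> _; exists [::]; split=> // v; rewrite !inE => ->.
move=> hp; have [q [pq lq sq]] := IH b pp hp.
exists (b :: q); split=> //=.
  by rewrite pq eab xpair_eqE /= andbT; case: eqP aX => // ->; rewrite xX.
  by move=> v; rewrite inE => /orP[/eqP->|/sq vq]; rewrite ?mem_head // inE vq orbT.
Qed.

(** The path is started at its last vertex in [X]; as [y] is in [X], no later arc enters [y]. *)
Lemma suffix_del_edge e x y X a p : y \in X ->
  path e a p -> has (mem X) (a :: p) ->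
  exists b q, [/\ b \in X, path (del_edge e x y) b q, last b q = last a p &
                {subset b :: q <= a :: p}].
Proof.
move=> yX; elim: p a => [|b p IH] a.
  by rewrite /= orbF => _ aX; exists a, [::]; split=> //=.
move=> pp; have [hp _|hp] := boolP (has (mem X) (b :: p)).
  case/andP: pp => eab pp; have [c [q [cX pq lq sq]]] := IH b pp hp.
  by exists c, q; split=> // v /sq vp; rewrite inE vp orbT.
rewrite [has _ _]/= -/(has (mem X) (b :: p)) (negPf hp) orbF => aX.
exists a, (b :: p); split=> //.
apply: path_del_edge pp _; apply: contra hp => yp; apply/hasP; exists y => //.
Qed.

(* Göring's proof: delete an edge xy. If this creates a separator S of size
   k - 1, then k paths A -> S + x and k paths S + y -> B avoiding xy exist by
   induction, and they can only meet in S. *)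
Lemma menger e A B k :
  (forall Y, separates e A B Y -> k <= #|Y|) -> linked e A B k.
Proof.
have [n] := ubnP #|[set p | e p.1 p.2]|.
elim: n e A B => // n IH e A B; rewrite ltnS => en sepk.
have [[x y] /= exy|noe] := pickP [pred p | e p.1 p.2]; last first.
  (* Without arcs all paths are single vertices, so [A :&: B] separates and its elements serve as
     paths. *)
  have kAB : k <= #|A :&: B|.
    apply: sepk => a [|b p] /= aA; first by rewrite inE aA => _ ->.
    by case/andP=> eab; move: (noe (a, b)); rewrite /= eab.
  exists (fun i => (enum_val (widen_ord kAB i), [::])); split=> [i|i j ij v] /=.
    by have := enum_valP (widen_ord kAB i); rewrite inE => /andP[].
  rewrite !inE => /eqP->; apply: contra ij => /eqP/enum_val_inj/(congr1 val) /= ij.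
  by apply/eqP/val_inj.
pose e' := del_edge e x y.
have e'n : #|[set p | e' p.1 p.2]| < n.
  apply: leq_trans en; apply: proper_card; apply/properP; split.
    by apply/subsetP => p; rewrite !inE => /andP[].
  by exists (x, y); rewrite !inE /= ?exy ?eqxx ?andbF.
case: (classic (forall Y, separates e' A B Y -> k <= #|Y|)) => [e'k|].
  exact: linked_sub (@del_edge_sub e x y) (IH _ _ _ e'n e'k).
move=> /not_all_ex_not nS; have [S hS] := nS; have [sepS /negP] := imply_to_and _ _ hS.
rewrite -ltnNge => Sk.
(* A path that avoids [z] avoids the deleted arc, so [S] plus one end of the arc separates in [e];
   as [S] has fewer than k elements, the sum has exactly k. *)
have sepe z : z \in [:: x; y] -> separates e A B (z |: S).
  move=> zxy a p aA pp lB; have [zp|zp] := boolP (z \in a :: p).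
    by apply/hasP; exists z; rewrite //= setU11.
  have pp' : path e' a p.
    move: zxy zp; rewrite !inE => /orP[] /eqP->.
      by move=> zp; apply: path_del_edge_src.
    by rewrite negb_or => /andP[_]; apply: path_del_edge.
  have /hasP[u up uS] := sepS a p aA pp' lB.
  by apply/hasP; exists u => //=; apply: setU1r.
have cz z : z \in [:: x; y] -> z \notin S /\ #|z |: S| = k.
  by move=> /sepe/sepk; rewrite cardsU1; case: (z \in S) => /=; lia.
have [xS cx] : x \notin S /\ #|x |: S| = k by apply: cz; rewrite mem_head.
have [yS cy] : y \notin S /\ #|y |: S| = k by apply: cz; rewrite !inE eqxx orbT.
(* Each path from [A] to [B] has an initial part that reaches [x |: S] without the deleted arc, so a
   separator for the smaller problem also separates [A] from [B]. *)
have [P [PP PD]] : linked e' A (x |: S) k.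
  apply: IH => // Y sepY; apply: sepk => a p aA pp lB.
  have hx := sepe x (mem_head _ _) a p aA pp lB.
  have [q [pq lq sq]] := @prefix_del_edge e x y _ a p (setU11 _ _) pp hx.
  by have /hasP[u /sq up uY] := sepY a q aA pq lq; apply/hasP; exists u.
have [Q [QP QD]] : linked e' (y |: S) B k.
  apply: IH => // Y sepY; apply: sepk => a p aA pp lB.
  have yxy : y \in [:: x; y] by rewrite !inE eqxx orbT.
  have hy := sepe y yxy a p aA pp lB.
  have [b [q [bX pq lq sq]]] := @suffix_del_edge e x y _ a p (setU11 _ _) pp hy.
  by rewrite -lq in lB; have /hasP[u /sq up uY] := sepY b q bX pq lB; apply/hasP; exists u.
have Plast := @linked_last _ k P (fun i => let: And4 _ h _ _ := PP i in h) PD cx.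
have Qfirst := @linked_first _ k Q (fun i => let: And4 h _ _ _ := QP i in h) QD cy.
have onP i u : u \in S -> u \in (P i).1 :: (P i).2 -> u = last (P i).1 (P i).2.
  move=> uS uP; have [j ju] := Plast u (setU1r x uS).
  have [<-//|ij] := eqVneq j i; have := PD j i ij u.
  by rewrite uP -ju mem_last => /(_ isT).
have onQ j u : u \in S -> u \in (Q j).1 :: (Q j).2 -> u = (Q j).1.
  move=> uS uQ; have [i iu] := Qfirst u (setU1r y uS).
  have [<-//|ij] := eqVneq i j; have := QD i j ij u.
  by rewrite uQ -iu mem_head => /(_ isT).
(* Following [P i] up to [v] and then [Q j] gives a walk that must hit [S]. It can do so only at the
   end of [P i] or at the start of [Q j], which forces [v] to be both. *)
have cross i j v : v \in (P i).1 :: (P i).2 -> v \in (Q j).1 :: (Q j).2 ->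
    [/\ v \in S, v = last (P i).1 (P i).2 & v = (Q j).1].
  move=> vP vQ; have [aA _ pP uP] := PP i; have [_ bB pQ uQ] := QP j.
  have sP := onP i; have sQ := onQ j.
  case: (P i) (Q j) vP vQ aA pP uP bB pQ uQ sP sQ => [a p] [b q] /=.
  case/splitPl => p1 p2 lp1; case/splitPl => q1 q2 lq1 aA.
  rewrite cat_path lp1 => /andP[pp1 _] uP; rewrite last_cat lq1 => bB.
  rewrite cat_path lq1 => /andP[_ pq2] uQ sP sQ.
  have pth : path e' a (p1 ++ q2) by rewrite cat_path pp1 lp1.
  have lst : last a (p1 ++ q2) \in B by rewrite last_cat lp1.
  have /hasP[u] := sepS _ _ aA pth lst; rewrite -cat_cons mem_cat /= => /orP[up1|uq2] uS.
    have ul : u = last a (p1 ++ p2) by apply: sP; rewrite // -cat_cons mem_cat up1.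
    have p20 : p2 = [::].
      case: (lastP p2) ul uP => // p3 z; rewrite last_cat last_rcons => <-.
      rewrite -cons_uniq -cat_cons cat_uniq => /and3P[_ /hasPn /(_ u)].
      by rewrite mem_rcons mem_head up1 => /(_ isT).
    move: ul; rewrite p20 cats0 lp1 => uv; rewrite uv in uS.
    by split=> //; apply: sQ; rewrite // -cat_cons mem_cat -{1}lq1 mem_last.
  have ub : u = b by apply: sQ; rewrite // -cat_cons mem_cat uq2 orbT.
  by move: uQ; rewrite -ub mem_cat uq2 orbT.
(* [P] and [Q] are matched at their common vertices of [S], while the path that ends in [x]
   continues through the arc to [y]. *)
pose sg z := if z == x then y else z.
have jP i : exists j, (Q j).1 = sg (last (P i).1 (P i).2).
  apply: Qfirst; have [_ + _ _] := PP i; rewrite /sg.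
  by rewrite !inE; case: eqVneq => [_ _|_ /= ->]; rewrite ?eqxx ?orbT.
have [j jE] := fin_all_exists jP.
pose R i := ((P i).1, (P i).2 ++
   (if last (P i).1 (P i).2 == x then (Q (j i)).1 :: (Q (j i)).2 else (Q (j i)).2)).
have RPQ i v : v \in (R i).1 :: (R i).2 ->
    v \in (P i).1 :: (P i).2 \/ v \in (Q (j i)).1 :: (Q (j i)).2.
  rewrite /R /= -cat_cons mem_cat => /orP[]; first by left.
  by case: ifP => _ vQ; right => //; rewrite inE vQ orbT.
have Pinj i l : last (P i).1 (P i).2 = last (P l).1 (P l).2 -> i = l.
  move=> il; apply/eqP/negP => /negP/PD/(_ _ (mem_last _ _)).
  by rewrite il mem_last.
have lastS i : last (P i).1 (P i).2 != x -> last (P i).1 (P i).2 \in S.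
  by have [_ + _ _] := PP i; rewrite !inE => /orP[->|].
have crossN i l v : i != l -> v \in (P i).1 :: (P i).2 ->
    v \in (Q (j l)).1 :: (Q (j l)).2 -> False.
  move=> il vP vQ; have [vS vi] := cross _ _ _ vP vQ.
  rewrite jE /sg; case: eqP => [_ vy|_ vl]; first by rewrite -vy vS in yS.
  by rewrite (Pinj i l) ?eqxx // -?vi -?vl in il.
apply: (@linked_shorten e A B k R) => [i|i l il v vi].
  have [aA _ pP _] := PP i; have [_ bB pQ _] := QP (j i).
  have sub := @del_edge_sub e x y.
  move: (jE i); rewrite /R /sg /=; case: eqP => [lx|lx] Qy; split=> //.
  - by rewrite last_cat.
  - by rewrite cat_path (sub_path sub pP) lx /= Qy exy -Qy (sub_path sub).
  - by rewrite last_cat -Qy.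
  - by rewrite cat_path (sub_path sub pP) -Qy (sub_path sub).
apply/negP => /RPQ vl; case/RPQ: vi => vi; case: vl => vl.
- by have := PD i l il v vi; rewrite vl.
- exact: crossN il vi vl.
- by apply: crossN vl vi; rewrite eq_sym.
- have jil : j i != j l.
    apply: contra il => /eqP jil; apply/eqP/Pinj; move: (jE i); rewrite jil jE /sg.
    case: eqP => [->|/eqP/lastS lS]; case: eqP => [->|/eqP/lastS iS] // h.
      by rewrite h iS in yS.
    by rewrite -h lS in yS.
  by have := QD _ _ jil v vi; rewrite vl.
Qed.

End Menger.

(** * Trees and tree-decompositions *)

Section Connectivity.
Variable T : finType.
Implicit Types (e : rel T) (A B C X : {set T}).

Lemma connect_exit e X x z : x \in X -> z \notin X -> connect e x z ->
  exists a b, [/\ connect e x a, a \in X, b \notin X & e a b].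
Proof.
move=> xX zX /connectP[p]; elim: p x xX => [|y p IH] x xX /=; first by move=> _ zx; rewrite zx xX in zX.
case/andP=> exy pp lz; have [yX|yX] := boolP (y \in X); last by exists x, y.
have [a [b [ca aX bX eab]]] := IH y yX pp lz; exists a, b; split=> //.
exact: connect_trans (connect1 exy) ca.
Qed.

Definition nbhd e C := [set v | v \notin C & [exists u in C, e u v]].

Lemma nbhdP e C v :
  reflect (v \notin C /\ exists2 u, u \in C & e u v) (v \in nbhd e C).
Proof.
rewrite inE; apply: (iffP andP) => -[vC].
  by case/exists_inP=> u uC euv; split=> //; exists u.
by case=> u uC euv; split=> //; apply/exists_inP; exists u.
Qed.

(* Connectivity of the subgraph induced on C, in the form in which it is used:
   every proper nonempty part of C has an edge to the rest of C. *)
Definition cut_connected e C := C != set0 /\ forall X, X \proper C -> X != set0 ->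
  exists x y, [/\ x \in X, y \in C, y \notin X & e x y].

Definition induced e X := [rel a b | [&& e a b, a \in X & b \in X]].

Lemma component_cut_connected e X x : symmetric e -> x \in X ->
  cut_connected e [set z | connect (induced e X) x z].
Proof.
move=> se xX; have symi : connect_sym (induced e X).
  apply: sym_connect_sym => a b /=.
  by rewrite se [(b \in X) && _]andbC.
split=> [|Y]; first by apply/set0Pn; exists x; rewrite inE.
case/properP=> /subsetP YK [z + zY] /set0Pn[y yY]; have := YK y yY; rewrite !inE.
move=> cxy cxz; have cyz : connect (induced e X) y z.
  by apply: connect_trans cxz; rewrite symi.
have [a [b [ca aY bY iab]]] := connect_exit yY zY cyz.
exists a, b; split=> //; last by case/andP: iab.
by rewrite inE (connect_trans _ (connect1 iab)) // (connect_trans cxy).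
Qed.

End Connectivity.

Section Tree.
Variable k : nat.

(** A vertex set is grown one vertex at a time; the edge that joins a new vertex to the old ones
    counts as two ordered pairs. *)
Lemma connected_edges (tr : rel 'I_k) : 0 < k -> irreflexive tr -> symmetric tr ->
  (forall a b, connect tr a b) -> (k.-1).*2 <= #|[set p | tr p.1 p.2]|.
Proof.
move=> k0 irr sym conn.
pose E (S : {set 'I_k}) := [set p | [&& tr p.1 p.2, p.1 \in S & p.2 \in S]].
suff [S SE] : exists S : {set 'I_k}, #|S| = k.-1.+1 /\ (k.-1).*2 <= #|E S|.
  by apply: leq_trans SE.2 (subset_leq_card _); apply/subsetP => p; rewrite !inE => /andP[].
have : k.-1 < k by lia.
elim: k.-1 => [_|m IH mk]; first by exists [set Ordinal k0]; rewrite cards1.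
have [S [cS lS]] := IH (ltnW mk).
have [x xS] : exists x, x \in S by apply/set0Pn; rewrite -card_gt0 cS.
have [z] : exists z, z \in ~: S by apply/set0Pn; rewrite -card_gt0 cardsCs setCK card_ord cS subn_gt0.
rewrite inE => zS; have [a [b [_ aS bS tab]]] := connect_exit xS zS (conn x z).
exists (b |: S); rewrite cardsU1 bS cS; split=> //.
have ab : a != b by apply: contraNneq bS => <-.
have dis : [disjoint [set (a, b); (b, a)] & E S].
  apply/pred0P => p /=; rewrite !inE; apply/negP => /andP[].
  by move=> /orP[] /eqP-> /=; rewrite (negPf bS) ?andbF.
apply: (@leq_trans #|[set (a, b); (b, a)] :|: E S|).
  rewrite cardsU disjoint_setI0 // cards0 subn0 cards2.
  by rewrite xpair_eqE (negPf ab) /= doubleS; exact: lS.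
apply/subset_leq_card/subsetP => p; rewrite !inE => /orP[/orP[]/eqP->|/and3P[-> -> ->]] /=.
- by rewrite tab aS eqxx orbT.
- by rewrite sym tab aS eqxx orbT.
- by rewrite !orbT.
Qed.

Definition del_pair (tr : rel 'I_k) (x y : 'I_k) :=
  [rel a b | [&& tr a b, (a, b) != (x, y) & (a, b) != (y, x)]].

Lemma del_pair_sym tr x y : symmetric tr -> symmetric (del_pair tr x y).
Proof.
move=> sym a b /=; rewrite sym !xpair_eqE ![(a == _) && _]andbC.
by rewrite [~~ _ && _]andbC.
Qed.

(** If [x] and [y] stayed connected, the relation without this edge would be connected with fewer
    pairs than [connected_edges] allows. *)
Lemma tree_bridge (tr : rel 'I_k) x y : is_tree tr -> tr x y -> ~~ connect (del_pair tr x y) x y.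
Proof.
case=> k0 irr sym conn ce txy; apply/negP => cxy.
have xy : x != y by apply: contraTneq txy => ->; rewrite irr.
have symd := del_pair_sym x y sym.
have cc a b : connect (del_pair tr x y) a b.
  have := conn a b; apply: connect_sub => u v tuv.
  have [/eqP[-> ->]//|uv] := boolP ((u, v) == (x, y)).
  have [/eqP[-> ->]|vu] := boolP ((u, v) == (y, x)).
    by rewrite (sym_connect_sym symd).
  by apply: connect1; rewrite /= tuv uv.
have irrd : irreflexive (del_pair tr x y) by move=> a /=; rewrite irr.
have := connected_edges k0 irrd symd cc.
rewrite leqNgt -ce proper_card //; apply/properP; split.
  by apply/subsetP => p; rewrite !inE => /andP[].
by exists (x, y); rewrite !inE //= eqxx andbF.
Qed.

End Tree.

Section BagStep.
Variables (T : finType) (e : rel T) (k : nat) (tr : rel 'I_k) (bag : 'I_k -> {set T}).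
Hypothesis tree_tr : is_tree tr.
Hypothesis bag_vertex : forall v, exists t, v \in bag t.
Hypothesis bag_edge : forall u v, e u v -> exists t, (u \in bag t) && (v \in bag t).
Hypothesis bag_subtree : forall v t1 t2, v \in bag t1 -> v \in bag t2 ->
  connect [rel a b | [&& tr a b, v \in bag a & v \in bag b]] t1 t2.

(* The nodes whose bags meet C form a subtree. If t is not one of them, the
   node s at which the tree path from t enters that subtree will do: the last
   edge s's of this path is a bridge, so the subtree of any neighbor of C,
   containing t and meeting the subtree of C, must contain s. *)
Lemma bag_step C t : cut_connected e C -> nbhd e C \subset bag t ->
  exists s, nbhd e C \subset bag s /\ exists2 c, c \in C & c \in bag s.
Proof.
move=> [/set0Pn[c0 c0C] cutC] Nt.
have [k0 irr symt conn ce] := tree_tr.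
have [D DE] : exists D : {set 'I_k}, forall a, (a \in D) = [disjoint bag a & C].
  by exists [set a | [disjoint bag a & C]] => a; rewrite inE.
have notD c a : c \in C -> c \in bag a -> a \notin D.
  by move=> cC ca; rewrite DE; apply/pred0Pn; exists c; rewrite /= ca cC.
have [tD|tD] := boolP (t \in D); last first.
  by exists t; split=> //; move: tD; rewrite DE => /pred0Pn[c /andP[? ?]]; exists c.
have [t0 c0t0] := bag_vertex c0.
pose P := [set a in D | connect (induced tr D) t a].
have tP : t \in P by rewrite inE tD connect0.
have t0P : t0 \notin P by rewrite inE (negPf (notD _ _ c0C c0t0)).
have [s' [s [_ + + ts's]]] := connect_exit tP t0P (conn t t0).
rewrite !inE => /andP[s'D cts'] nsP.
have sD : s \notin D.
  apply: contra nsP => sD; rewrite sD (connect_trans cts') //.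
  by apply: connect1; rewrite /= ts's s'D.
have ss : symmetric (del_pair tr s' s) by apply: del_pair_sym.
have [A AE] : exists A : {set 'I_k}, forall a, (a \in A) = connect (del_pair tr s' s) s' a.
  by exists [set a | connect (del_pair tr s' s) s' a] => a; rewrite inE.
have closA : closed (del_pair tr s' s) (mem A).
  apply: intro_closed => [|a b ab]; first exact: sym_connect_sym.
  by rewrite !AE => /connect_trans; apply; apply: connect1.
(* [A] is the side of [s'] once the bridge is deleted; the subtree of a vertex that is missing from
   the bag at one end of the bridge cannot cross it. *)
have subA v a b r : v \in bag a -> v \in bag b -> r \in [:: s'; s] -> v \notin bag r ->
    (a \in A) = (b \in A).
  move=> va vb rs vr; apply: (closed_connect closA).
  apply: connect_sub (bag_subtree va vb) => a' b' /= /and3P[tab va' vb'].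
  have ar : a' != r by apply: contraNneq vr => <-.
  have br : b' != r by apply: contraNneq vr => <-.
  apply: connect1; rewrite /= tab !xpair_eqE.
  by move: rs ar br; rewrite !inE => /orP[]/eqP-> /negPf-> /negPf->; rewrite ?andbF.
have tA : t \in A.
  rewrite AE (sym_connect_sym ss); apply: connect_sub cts' => a b /= /and3P[tab aD bD].
  have sa : a != s by apply: contraNneq sD => <-.
  have sb : b != s by apply: contraNneq sD => <-.
  by apply: connect1; rewrite /= tab !xpair_eqE (negPf sa) (negPf sb) andbF.
have sA : s \notin A by rewrite AE tree_bridge.
have s'C c : c \in C -> c \notin bag s' by move=> cC; apply: contraL s'D => /(notD _ _ cC).
(* All bags that meet [C] are on the side of [s]: otherwise the part of [C] with a bag in [A] is
   proper, and an edge from it to the rest of [C] has its bag in [A] too, since [bag s'] misses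
   [C]. *)
have CA a c : c \in C -> c \in bag a -> a \notin A.
  move=> cC ca; apply/negP => aA.
  have [c1 c1C c1s] : exists2 c1, c1 \in C & c1 \in bag s.
    by move: sD; rewrite DE => /pred0Pn[c1 /andP[]]; exists c1.
  pose X := [set v in C | [exists a in A, v \in bag a]].
  have XC : X \proper C.
    apply/properP; split; first by apply/subsetP => v; rewrite inE => /andP[].
    exists c1 => //; rewrite inE c1C /=; apply/exists_inPn => b bA; apply/negP => c1b.
    by rewrite -(subA c1 b s s') ?bA ?mem_head ?s'C // in sA.
  have [|x [y [+ yC + exy]]] := cutC X XC.
    by apply/set0Pn; exists c; rewrite inE cC; apply/exists_inP; exists a.
  rewrite !inE yC /= => /andP[xC /exists_inP[b bA xb]] /exists_inPn yX.
  have [b' /andP[xb' yb']] := bag_edge exy.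
  have := yX b'; rewrite yb' -(subA x b b' s') ?mem_head ?s'C // bA.
  by move/(_ isT).
exists s; split; last by move: sD; rewrite DE => /pred0Pn[c1 /andP[]]; exists c1.
apply/subsetP => u uN; have ut := subsetP Nt u uN.
have [_ [v vC evu]] := nbhdP _ _ _ uN; have [b /andP[vb ub]] := bag_edge evu.
have := CA b v vC vb; apply: contraR => us.
by rewrite -(subA u t b s) // !inE eqxx orbT.
Qed.
End BagStep.

(** * Long chains of connected sets *)

(** One step loses at most w + 1 vertices to a bag and leaves at most (w + 1)d components, one of
    which must exceed the bound for [N']. *)
Fixpoint chain_bound (w d N : nat) : nat :=
  if N is N'.+1 then w.+1 + w.+1 * d * chain_bound w d N' else 0.

Lemma card_bigcup_le (I T : finType) (P : {set I}) (F : I -> {set T}) :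
  #|\bigcup_(i in P) F i| <= \sum_(i in P) #|F i|.
Proof.
elim/big_rec2: _ => [|i m A _ IH]; first by rewrite cards0.
by apply: leq_trans (leq_card_setU _ _).1 _; rewrite leq_add2l.
Qed.

Section Chain.
Variables (T : finType) (e : rel T) (w d : nat).
Hypothesis sym_e : symmetric e.
Hypothesis deg_e : forall v, #|[set u | e v u]| <= d.
Implicit Types (C X Z : {set T}) (c : nat -> {set T}).

Definition chain L c :=
  (forall i, i <= L -> cut_connected e (c i) /\ #|nbhd e (c i)| <= w) /\
  (forall i, i < L -> c i.+1 \proper c i).

Lemma card_adjacent_setI X Y : #|[set v | [exists u in X, e u v]] :&: Y| <= #|X| * d.
Proof.
apply: (@leq_trans #|\bigcup_(u in X) [set v | e u v]|).
  apply/subset_leq_card/subsetP => v; rewrite !inE => /andP[/exists_inP[u uX euv] _].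
  by apply/bigcupP; exists u; rewrite // inE.
rewrite -sum_nat_const.
apply: leq_trans (card_bigcup_le _ _) _.
by apply: leq_sum => u _; apply: deg_e.
Qed.

Lemma long_chain (I : Type) (bag : I -> {set T}) N C t :
  (forall t, #|bag t| <= w.+1) ->
  (forall C t, cut_connected e C -> nbhd e C \subset bag t ->
     exists s, nbhd e C \subset bag s /\ exists2 x, x \in C & x \in bag s) ->
  cut_connected e [set: T] ->
  cut_connected e C -> nbhd e C \subset bag t -> chain_bound w d N < #|C| ->
  exists c, c 0 = C /\ chain N c.
Proof.
move=> card_bag step connT; elim: N C t => [|N IH] C t cutC Nt CN.
  have [s [Ns [x xC xs]]] := step C t cutC Nt.
  exists (fun=> C); split=> //; split=> // i _; split=> //.
  (* The bag has at most w + 1 elements, one of which lies in [C] and so not in its neighborhood. *)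
  rewrite -ltnS; apply: leq_trans (card_bag s); apply: proper_card.
  by apply/properP; split=> //; exists x => //; apply/negP => /nbhdP[]; rewrite xC.
have [s [Ns [x xC xs]]] := step C t cutC Nt.
have NCw : #|nbhd e C| <= w.
  rewrite -ltnS; apply: leq_trans (card_bag s); apply: proper_card.
  by apply/properP; split=> //; exists x => //; apply/negP => /nbhdP[]; rewrite xC.
pose D := C :\: bag s.
pose K y := [set z | connect (induced e D) y z].
have KD y : y \in D -> K y \subset D.
  move=> yD; apply/subsetP => z; rewrite inE => /connectP[p pp ->].
  elim: p y yD pp => //= a p IHp y yD /andP[/and3P[_ _ aD]].
  exact: IHp.
have KN y : y \in D -> nbhd e (K y) \subset bag s.
  move=> yD; apply/subsetP => v /nbhdP[vK [u uK euv]]; apply: contraR vK => vs.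
  have /setDP[uC us] := subsetP (KD y yD) u uK.
  have vC : v \in C.
    apply: contraR vs => vC; apply: (subsetP Ns); apply/nbhdP; split=> //.
    by exists u.
  move: uK; rewrite !inE => /connect_trans; apply; apply: connect1.
  by rewrite /= euv !inE us uC vs vC.
have [y yD yK] : exists2 y, y \in D & chain_bound w d N < #|K y|.
  apply/exists_inP; apply: contraLR CN; rewrite negb_exists_in => /forall_inP KN'.
  rewrite -leqNgt -(cardsID (bag s)) leq_add //.
    by apply: leq_trans (card_bag s); apply/subset_leq_card/subsetIr.
  (* As the graph is connected, every component of [D] contains a neighbor of the bag; [B] collects
     these neighbors and so indexes the components. *)
  pose B := [set v | [exists u in bag s, e u v]] :&: D.
  apply: (@leq_trans #|\bigcup_(y in B) K y|).
    apply/subset_leq_card/subsetP => z zD.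
    have zK : z \in K z by rewrite inE connect0.
    have KT : K z \proper [set: T].
      apply/properP; split=> //; exists x => //.
      by apply/negP => /(subsetP (KD z zD)); rewrite !inE xs.
    have K0 : K z != set0 by apply/set0Pn; exists z.
    have [a [b [aK _ bK eab]]] := connT.2 (K z) KT K0.
    have bs : b \in bag s.
      by apply: (subsetP (KN z zD)); apply/nbhdP; split=> //; exists a.
    apply/bigcupP; exists a.
      by rewrite inE (subsetP (KD z zD)) // andbT inE; apply/exists_inP; exists b; rewrite // sym_e.
    move: aK; rewrite !inE (sym_connect_sym (e := induced e D)) // => u v /=.
    by rewrite sym_e [(v \in D) && _]andbC.
  apply: leq_trans (card_bigcup_le _ _) _.
  apply: (@leq_trans (\sum_(y in B) chain_bound w d N)).
    by apply: leq_sum => y /setIP[_ yD]; rewrite leqNgt KN'.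
  rewrite sum_nat_const leq_mul2r (leq_trans (card_adjacent_setI _ _)) ?orbT //.
  by rewrite leq_mul2r card_bag orbT.
have [c [c0 [cP cD]]] := IH (K y) s (component_cut_connected sym_e yD) (KN y yD) yK.
exists (fun i => if i is j.+1 then c j else C); split=> //; split=> [[|i]|[|i]] //=.
- exact: cP.
- rewrite c0 => _; apply/properP; split; last exists x => //.
    exact: subset_trans (KD y yD) (subsetDl _ _).
  by apply/negP => /(subsetP (KD y yD)); rewrite inE xs.
- exact: cD.
Qed.

Lemma chain_proper L c i j : chain L c -> i < j -> j <= L -> c j \proper c i.
Proof.
move=> [_ cD]; elim: j => // j IH; rewrite ltnS leq_eqVlt => /orP[/eqP->|ij] jL.
  exact: cD.
exact: proper_trans (cD _ jL) (IH ij (ltnW jL)).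
Qed.

Lemma chain_subset L c i j : chain L c -> i <= j -> j <= L -> c j \subset c i.
Proof.
move=> cc; rewrite leq_eqVlt => /orP[/eqP-> //|ij jL].
exact: proper_sub (chain_proper cc ij jL).
Qed.

Lemma subchain L c m (h : nat -> nat) : chain L c ->
  (forall i, i < m -> h i < h i.+1) -> h m <= L -> chain m (c \o h).
Proof.
move=> cc hm hL; have hle i : i <= m -> h i <= L.
  move=> im; apply: leq_trans hL; rewrite -(subnKC im).
  have : i + (m - i) <= m by rewrite subnKC.
  elim: (m - i) => [|j IH]; first by rewrite addn0.
  rewrite addnS => jm; exact: leq_trans (IH (ltnW jm)) (ltnW (hm _ jm)).
split=> i im; first by case: cc => /(_ _ (hle i im)).
exact: chain_proper cc (hm i im) (hle i.+1 im).
Qed.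

Lemma nbhd_between X0 X1 X2 v : X2 \subset X1 -> X1 \subset X0 ->
  v \in nbhd e X0 -> v \in nbhd e X2 -> v \in nbhd e X1.
Proof.
move=> X21 X10 /nbhdP[v0 _] /nbhdP[_ [u u2 euv]]; apply/nbhdP; split.
  exact: contra (subsetP X10 v) v0.
by exists u; first exact: (subsetP X21).
Qed.

(* Either the neighborhoods of the members of index 0, K, 2K, ... of the chain
   pairwise meet in Z only, or a vertex outside Z survives in all neighborhoods
   of a stretch of length K and can be added to Z. *)
Lemma stable_subchain q m L c Z : 0 < m -> L = m ^ q.+1 -> chain L c ->
  (forall i, i <= L -> Z \subset nbhd e (c i)) -> w <= #|Z| + q ->
  exists c' Z', [/\ chain m c', (forall i, i <= m -> Z' \subset nbhd e (c' i)) &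
    forall i, i < m -> nbhd e (c' i) :&: nbhd e (c' i.+1) \subset Z'].
Proof.
(* [q] bounds how many vertices [Z] can still gain; for q = 0 all neighborhoods equal [Z]. *)
move=> m0; elim: q L c Z => [|q IH] L c Z -> cc ZN wZ.
  rewrite expn1 in cc ZN.
  exists c, Z; split=> // i im.
  have /eqP -> : Z == nbhd e (c i).
    rewrite eqEcard ZN ?(ltnW im) //; apply: leq_trans (leq_trans wZ _); last by rewrite addn0.
    by case: cc => /(_ _ (ltnW im)) [].
  exact: subsetIl.
rewrite expnS in cc ZN; have {}IH := IH (m ^ q.+1); have := expn_gt0 m q.+1; rewrite m0 /=.
move: (m ^ q.+1) IH cc ZN => K IH cc ZN K0.
have [good|] := classic (forall i, i < m ->
    nbhd e (c (i * K)) :&: nbhd e (c (i.+1 * K)) \subset Z).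
  exists (fun i => c (i * K)), Z; split=> // [|i im].
    apply: (subchain (h := fun i => i * K) cc) => // i _.
    by rewrite mulSn -[X in X < _]add0n ltn_add2r.
  by apply: ZN; rewrite leq_mul2r im orbT.
move=> /not_all_ex_not bad; have [i bi] := bad.
have [im /negP/subsetPn[v /setIP[v1 v2] vZ]] := imply_to_and _ _ bi.
have iKL j : j <= K -> i * K + j <= m * K.
  by move=> jK; apply: (@leq_trans (i.+1 * K)); rewrite ?leq_mul2r ?im ?orbT // mulSn addnC leq_add2r.
apply: (IH (fun j => c (i * K + j)) (v |: Z)) => //.
- by apply: (subchain (h := fun j => i * K + j) cc) => [j _|]; rewrite ?addnS // iKL.
- move=> j jK; apply/subsetP => u /setU1P[->|uZ]; last by apply: (subsetP (ZN _ (iKL j jK))).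
  apply: nbhd_between v1 v2; last exact: chain_subset cc (leq_addr _ _) (iKL _ jK).
  apply: chain_subset cc _ _; first by rewrite mulSn addnC leq_add2r.
  by rewrite leq_mul2r im orbT.
- by rewrite cardsU1 vZ; lia.
Qed.

Definition border Z X : {set T} := nbhd e X :\: Z.

(* The vertices of Z are put into G_0, and the nest then behaves like a chain of
   separations with disjoint separators border Z (C i). *)
Record nest Z m (C : nat -> {set T}) : Prop := Nest {
  nest_dec : forall i, i < m -> C i.+1 \subset C i;
  nest_disj : forall z, z \in Z -> z \notin C 0;
  nest_border : forall i, i < m -> border Z (C i.+1) \subset C i;
  nest_far : forall z v, z \in Z -> v \in C 0 -> v \notin C m -> ~~ e z v;
  nest_link : forall X, C m \subset X -> X \subset C 0 -> border Z X != set0 }.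

(** The stable chain is cut into wd + 1 stretches of n + 1 steps. The at most w vertices of [Z] have
    at most wd neighbors, so some stretch has none of them between its first and its last set. *)
Lemma exists_nest n L c : L = (n.+1 * (w * d).+1) ^ w.+1 -> chain L c ->
  exists Z (C : nat -> {set T}), nest Z n C /\ forall i, i <= n -> #|border Z (C i)| <= w.
Proof.
move=> LE cc0; set m := n.+1 * _ in LE.
have [|||c' [Z [cc ZN NN]]] := @stable_subchain w m L c set0 _ LE cc0.
- by rewrite muln_gt0.
- by move=> i _; apply: sub0set.
- exact: leq_addl.
pose bad i := [exists z in Z, [exists v in c' (n.+1 * i) :\: c' (n.+1 * i.+1), e z v]].
have [s sm nb] : exists2 s, s < (w * d).+1 & ~~ bad s.
  have [/existsP[s nbs]|/existsPn allbad] := boolP [exists s : 'I_(w * d).+1, ~~ bad s].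
    by exists s.
  have hv (i : 'I_(w * d).+1) : exists v, (v \in [set v | [exists z in Z, e z v]]) &&
     (v \in c' (n.+1 * i) :\: c' (n.+1 * i.+1)).
    have := allbad i; rewrite negbK => /exists_inP[z zZ /exists_inP[v vc ezv]].
    by exists v; rewrite vc andbT inE; apply/exists_inP; exists z.
  have [h hP] := fin_all_exists hv.
  have ltinj (i j : 'I_(w * d).+1) : i < j -> h i != h j.
    move=> ij; apply/eqP => hij; have /andP[_ /setDP[_]] := hP i.
    have /andP[_ /setDP[hj _]] := hP j; rewrite hij (subsetP _ _ hj) //.
    apply: chain_subset cc _ _; first by rewrite leq_mul2l ij orbT.
    by rewrite leq_mul2l ltnW.
  have injh : injective h.
    move=> i j hij; apply: ord_inj.
    by case: (ltngtP i j) => // /ltinj /eqP[].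
  have := card_adjacent_setI Z [set: T]; rewrite setIT.
  have : #|h @: [set: 'I_(w * d).+1]| <= #|[set v | [exists z in Z, e z v]]|.
    by apply/subset_leq_card/subsetP => _ /imsetP[i _ ->]; have /andP[] := hP i.
  rewrite card_imset // cardsT card_ord => h1 h2.
  have : #|Z| * d <= w * d.
    rewrite leq_mul2r (leq_trans (subset_leq_card (ZN 0 _))) ?orbT //.
    by have [/(_ 0)[]] := cc.
  by move: (leq_trans h1 h2); lia.
have sL i : i <= n.+1 -> n.+1 * s + i <= m.
  by move=> iN; apply: (@leq_trans (n.+1 * s.+1)); rewrite ?leq_mul2l ?sm ?orbT // mulnS addnC leq_add2r.
pose a i := c' (n.+1 * s + i).
have aP i : i <= n.+1 -> cut_connected e (a i) /\ #|nbhd e (a i)| <= w.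
  by move=> iN; have [/(_ _ (sL i iN))] := cc.
have aD i j : i < j -> j <= n.+1 -> a j \proper a i.
  by move=> ij jn; apply: chain_proper cc _ (sL _ jn); rewrite ltn_add2l.
have aZ i : i <= n.+1 -> Z \subset nbhd e (a i) by move=> iN; apply: ZN; apply: sL.
have Za i z : i <= n.+1 -> z \in Z -> z \notin a i.
  by move=> iN /(subsetP (aZ i iN))/nbhdP[].
(* [a 0] is held back for [nest_link]: every nonempty [X] inside [a 1] is a proper part of the
   connected set [a 0], which is disjoint from [Z], and so has a border vertex there. *)
exists Z, (fun i => a i.+1); split; last first.
  by move=> i iN; apply: leq_trans (subset_leq_card (subsetDl _ _)) _; case: (aP i.+1).
split.
- by move=> i iN; apply: proper_sub; apply: aD.
- by move=> z; apply: Za.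
- move=> i iN; apply/subsetP => v /setDP[vN vZ]; apply: contraR vZ => va.
  have lti : n.+1 * s + i.+1 < m by rewrite -addnS; apply: sL.
  apply: (subsetP (NN _ lti)); rewrite -addnS in_setI -/(a i.+1) -/(a i.+2) vN andbT.
  apply/nbhdP; split=> //.
  have [_ [u ua euv]] := nbhdP _ _ _ vN; exists u => //.
  by apply: (subsetP (proper_sub (aD _ _ (ltnSn _) _)) _ ua).
- move=> z v zZ v1 vn; apply: contra nb => ezv; apply/exists_inP; exists z => //.
  apply/exists_inP; exists v => //; rewrite inE mulnSr vn.
  by rewrite -[n.+1 * s]addn0 (subsetP (proper_sub (aD 0 1 _ _))).
- move=> X nX X0; have [cut0 _] := aP 0 isT.
  have X0p : X \proper a 0 by apply: sub_proper_trans X0 (aD 0 1 _ _).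
  have Xn0 : X != set0.
    have /set0Pn[x xa] := (aP n.+1 (leqnn _)).1.1.
    by apply/set0Pn; exists x; apply: (subsetP nX).
  have [x [y [xX ya yX exy]]] := cut0.2 X X0p Xn0.
  apply/set0Pn; exists y; rewrite inE (contraL (Za 0 y isT)) //=.
  by apply/nbhdP; split=> //; exists x.
Qed.

End Chain.

(** * Gaps of a nest *)

Section Gap.
Variables (T : finType) (e : rel T).
Hypothesis sym_e : symmetric e.
Implicit Types (D X Z K : {set T}) (C : nat -> {set T}).

Lemma subnest Z m C q (h : nat -> nat) : nest e Z m C ->
  (forall i, i < q -> h i < h i.+1) -> h q <= m -> nest e Z q (C \o h).
Proof.
move=> [dec disj bor far lnk] hq qm.
have hh i j : i <= j -> j <= q -> h i <= h j.
  elim: j => [|j IH]; first by rewrite leqn0 => /eqP->.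
  rewrite leq_eqVlt => /orP[/eqP->//|ij jq].
  exact: leq_trans (IH ij (ltnW jq)) (ltnW (hq _ jq)).
have CC i j : i <= j -> j <= m -> C j \subset C i.
  elim: j => [|j IH]; first by rewrite leqn0 => /eqP->.
  rewrite leq_eqVlt => /orP[/eqP->//|ij jq].
  exact: subset_trans (dec _ jq) (IH ij (ltnW jq)).
have h0m : h 0 <= m by apply: leq_trans qm; apply: hh.
have C0 : C (h 0) \subset C 0 by apply: CC.
have Cq : C m \subset C (h q) by apply: CC.
split=> /=.
- by move=> i iq; apply: CC; [apply: ltnW (hq _ iq)|apply: leq_trans qm; apply: hh].
- by move=> z /disj; apply/contra/(subsetP C0).
- move=> i iq; have := hq i iq; have : h i.+1 <= m by apply: leq_trans qm; apply: hh.
  case: (h i.+1) => // j jm; rewrite ltnS => ij.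
  exact: subset_trans (bor _ jm) (CC _ _ ij (ltnW jm)).
- move=> z v zZ v0 vq; apply: far => //; first exact: (subsetP C0).
  by apply: contra vq; apply: (subsetP Cq).
- by move=> X qX X0; apply: lnk; [exact: subset_trans Cq qX|exact: subset_trans X0 C0].
Qed.

Record gap Z D D' : Prop := Gap {
  gap_sub : D' \subset D;
  gap_disj : forall z, z \in Z -> z \notin D;
  gap_border : border e Z D' \subset D;
  gap_far : forall z v, z \in Z -> v \in D -> v \notin D' -> ~~ e z v }.

Lemma nest_gap Z m C i j : nest e Z m C -> i < j -> j <= m -> gap Z (C i) (C j).
Proof.
move=> nC ij jm.
have [dec disj bor far _] : nest e Z 1 (C \o (fun l => if l is 0 then i else j)).
  by apply: subnest nC _ _ => [[]|].
by split; [exact: (dec 0)|exact: disj|exact: (bor 0)|exact: far].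
Qed.

Definition region Z D D' : {set T} := border e Z D :|: (D :\: D').

(** Edges inside the border of [D] are left to an earlier piece, which keeps the pieces
    edge-disjoint. *)
Definition region_rel D D' : rel T :=
  [rel u v | [&& e u v, (u \in D) || (v \in D), u \notin D' & v \notin D']].

Lemma region_rel_sym D D' : symmetric (region_rel D D').
Proof. by move=> u v; rewrite /region_rel /= sym_e orbC [(u \notin _) && _]andbC. Qed.

Lemma mem_border Z X u v : u \in X -> e u v -> v \notin X -> v \notin Z ->
  v \in border e Z X.
Proof. by move=> uX euv vX vZ; rewrite inE vZ; apply/nbhdP; split=> //; exists u. Qed.

Lemma borderP Z X v : v \in border e Z X ->
  [/\ v \notin Z, v \notin X & exists2 u, u \in X & e u v].
Proof. by case/setDP=> /nbhdP[]. Qed.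

Variables (Z D D' : {set T}).
Hypothesis gD : gap Z D D'.
Local Notation r := (region_rel D D').

Lemma region_rel_far a b : a \in D -> r a b -> b \notin Z.
Proof.
move=> aD /and4P[eab _ aD' _]; apply: contraL eab => bZ.
by rewrite sym_e (gap_far gD).
Qed.

Lemma region_rel_region a b : r a b -> b \in region Z D D'.
Proof.
move=> rab; have /and4P[eab Dab aD' bD'] := rab; rewrite in_setU in_setD bD'.
have [bD|bD] := boolP (b \in D); first by rewrite orbT.
move: Dab; rewrite (negPf bD) orbF => aD.
by rewrite (mem_border aD eab bD) // (region_rel_far aD).
Qed.

Lemma region_connect a b : a \in region Z D D' -> connect r a b -> b \in region Z D D'.
Proof.
move=> aR cab; apply: contraT => bR.
by have [u [v [_ _ /negP + /region_rel_region]]] := connect_exit aR bR cab.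
Qed.

(* If Y separates border D from border D', the set of vertices that are in D' or
   on the D' side of Y has its border in Y. *)
Lemma gap_linked k :
  (forall X, D' \subset X -> X \subset D -> k <= #|border e Z X|) ->
  linked r (border e Z D) (border e Z D') k.
Proof.
move=> kX; apply: menger => Y sepY.
have [q qE] : exists q, forall a b, q a b = [&& r a b, a \notin Y & b \notin Y].
  by exists [rel a b | [&& r a b, a \notin Y & b \notin Y]].
have symq : connect_sym q.
  by apply: sym_connect_sym => a b; rewrite !qE region_rel_sym [(a \notin Y) && _]andbC.
pose X := D' :|: [set v | (v \notin Y) && [exists s in border e Z D' :\: Y, connect q s v]].
(* An edge from the [D'] side of [Y] out of [D] would end in the border of [D], giving a path to the
   border of [D'] that avoids [Y]. *)
have XD : X \subset D.
  apply/subsetP => v /setUP[/(subsetP (gap_sub gD)) //|].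
  rewrite inE => /andP[vY /exists_inP[s /setDP[sB sY] csv]].
  apply: contraT => vD; have sD := subsetP (gap_border gD) s sB.
  have [a [b [ca aD bD qab]]] := connect_exit sD vD csv.
  have := qab; rewrite qE => /and3P[rab aY bY]; have /and4P[eab _ _ _] := rab.
  have bB := mem_border aD eab bD (region_rel_far aD rab).
  have : connect q b s.
    by rewrite symq (connect_trans ca) // connect1.
  case/connectP=> p pp lp; rewrite lp in sB.
  have rp : path r b p by apply: sub_path pp => ? ?; rewrite qE => /andP[].
  have /hasP[u] := sepY b p bB rp sB.
  rewrite inE => /orP[/eqP->|]; first by move=> /= bY'; rewrite bY' in bY.
  have : all (mem (~: Y)) p.
    elim: p b pp {eab bY bD rab bB lp sB rp qab} => //= c p IH b /andP[].
    by rewrite qE inE => /and3P[_ _ ->] /IH.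
  by move=> /allP/[apply]; rewrite /= inE => /negP.
apply: leq_trans (kX X (subsetUl _ _) XD) (subset_leq_card _).
apply/subsetP => v /borderP[vZ + [u uX euv]]; apply: contraR => vY.
have [vD'|vD'] := boolP (v \in D'); first by rewrite in_setU vD'.
rewrite in_setU inE vY; apply/orP; right=> /=; apply/exists_inP.
have [uD'|uD'] := boolP (u \in D').
  by exists v; rewrite ?connect0 // inE vY (mem_border uD').
have uD := subsetP XD u uX.
move: uX; rewrite in_setU (negPf uD') inE => /andP[uY /exists_inP[s sB csu]].
exists s => //; apply: connect_trans csu (connect1 _).
by rewrite qE /region_rel /= euv uD uD' vD' uY.
Qed.

(* From here on, the border-to-border paths cover both borders; since the whole
   graph is connected, each component of the region then contains one of them. *)
Section Components.
Hypothesis connT : cut_connected e [set: T].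
Hypothesis border0 : border e Z D != set0.
Variables (k : nat) (ps : 'I_k -> T * seq T).
Hypothesis psP : forall i, [/\ (ps i).1 \in border e Z D,
  last (ps i).1 (ps i).2 \in border e Z D', path r (ps i).1 (ps i).2 &
  uniq ((ps i).1 :: (ps i).2)].
Hypothesis psD : forall i j, i != j -> forall v,
  v \in (ps i).1 :: (ps i).2 -> v \notin (ps j).1 :: (ps j).2.
Hypothesis cardD : #|border e Z D| = k.
Hypothesis cardD' : #|border e Z D'| = k.

Lemma component_path x : x \in region Z D D' ->
  exists s t, [/\ s \in border e Z D, t \in border e Z D', connect r x s & connect r x t].
Proof.
move=> xR; have symr := sym_connect_sym (region_rel_sym D D').
(* It is enough to reach either border: each has k vertices, so all of them lie on the k paths. *)
suff [v vB cxv] : exists2 v, v \in border e Z D :|: border e Z D' & connect r x v.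
  have psc i : connect r (ps i).1 (last (ps i).1 (ps i).2).
    by have [_ _ pp _] := psP i; apply/connectP; exists (ps i).2.
  have [i iv] : exists i, connect r (ps i).1 v.
    case/setUP: vB => vB.
      have [|i <-] := linked_first (A := border e Z D) _ psD cardD vB.
        by move=> i; have [] := psP i.
      by exists i; apply: connect0.
    have [|i <-] := linked_last (B := border e Z D') _ psD cardD' vB.
      by move=> i; have [] := psP i.
    by exists i.
  have [sB tB _ _] := psP i; exists (ps i).1, (last (ps i).1 (ps i).2).
  have cx : connect r x (ps i).1 by rewrite (connect_trans cxv) // symr.
  by split=> //; apply: connect_trans cx (psc i).
(* A component that avoids both borders would be closed under all edges of the graph. *)
pose K := [set v | connect r x v].
apply/exists_inP; apply: contraT; rewrite negb_exists_in => /forall_inP noB.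
have [s sB] := set0Pn _ border0.
have KT : K \proper [set: T].
  apply/properP; split=> //; exists s => //; rewrite inE.
  by apply: noB; rewrite inE sB.
have K0 : K != set0 by apply/set0Pn; exists x; rewrite inE connect0.
have [a [b [+ _ + eab]]] := connT.2 K KT K0; rewrite !inE => ca /negP; case.
have aR := region_connect xR ca; apply: connect_trans (ca) (connect1 _).
have anB : a \notin border e Z D :|: border e Z D' by apply/negP => /noB; rewrite ca.
move: anB aR; rewrite in_setU negb_or in_setU => /andP[/negPf-> aD'B] /= /setDP[aD aD'].
rewrite /region_rel /= eab aD aD' /=; apply: contra aD'B => bD'.
apply: mem_border bD' _ aD' _; first by rewrite sym_e.
by apply/negP => /(gap_disj gD); rewrite aD.
Qed.

(** The component contains a path from the border of [D'], inside [X], to the border of [D], outside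
    [X]; where the path leaves [X], it enters the border of [X]. *)
Lemma component_meets x X : x \in region Z D D' -> D' \subset X -> X \subset D ->
  border e Z D' \subset X -> exists2 v, v \in border e Z X & connect r x v.
Proof.
move=> xR D'X XD bX; have [s [t [sB tB cs ct]]] := component_path xR.
have symr := sym_connect_sym (region_rel_sym D D').
have tX := subsetP bX t tB.
have sX : s \notin X by have [_ sD _] := borderP sB; apply: contra sD; apply: (subsetP XD).
have cts : connect r t s by apply: connect_trans cs; rewrite symr.
have [a [b [cta aX bX' rab]]] := connect_exit tX sX cts.
exists b; last by apply: connect_trans (connect_trans ct cta) (connect1 rab).
have /and4P[eab _ _ _] := rab.
exact: (mem_border aX eab bX' (region_rel_far (subsetP XD a aX) rab)).
Qed.

End Components.
End Gap.

(** * Induction on the size of the borders *)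

Section Reduction.
Variables (T : finType) (e : rel T).
Hypothesis sym_e : symmetric e.
Hypothesis connT : cut_connected e [set: T].
Implicit Types (D X Z K : {set T}) (C F : nat -> {set T}).

(* If a stretch of the nest is disconnected, restrict it to the component K of
   x: the component of y takes away at least one vertex of each separator. *)
Lemma component_nest Z L F k x y (r := region_rel e (F 0) (F L)) : 0 < L -> nest e Z L F ->
  linked r (border e Z (F 0)) (border e Z (F L)) k.+1 ->
  #|border e Z (F 0)| = k.+1 -> #|border e Z (F L)| = k.+1 ->
  (forall i, i <= L -> #|border e Z (F i)| <= k.+1) ->
  x \in region e Z (F 0) (F L) -> y \in region e Z (F 0) (F L) -> ~~ connect r x y ->
  exists Z' C, nest e Z' L C /\ forall i, i <= L -> #|border e Z' (C i)| <= k.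
Proof.
move=> L0 nF [ps [psP psD]] c0 cL ck xR yR ncxy.
have gF := nest_gap nF L0 (leqnn L).
have b0 : border e Z (F 0) != set0 by rewrite -card_gt0 c0.
have cpath := component_path sym_e gF connT b0 psP psD c0 cL.
have cmeet := component_meets sym_e gF connT b0 psP psD c0 cL.
have symr : connect_sym r := sym_connect_sym (region_rel_sym sym_e (F 0) (F L)).
have FF i j : i < j -> j <= L -> F j \subset F i.
  by move=> ij jL; have [] := nest_gap nF ij jL.
have F0 i : i <= L -> F i \subset F 0 by case: i => // i; apply: FF.
have FL i : i <= L -> F L \subset F i.
  by rewrite leq_eqVlt => /orP[/eqP->//|iL]; apply: FF.
have [K KE] : exists K : {set T}, forall v, (v \in K) = connect r x v.
  by exists [set v | connect r x v] => v; rewrite inE.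
have KZ v : v \in K -> v \notin Z.
  rewrite KE => /(region_connect sym_e gF xR); rewrite !inE => /orP[/andP[]//|/andP[_]].
  by apply: contraL; apply: gap_disj gF _.
have Krel u v : u \in K -> r u v -> v \in K.
  by rewrite !KE => cxu ruv; apply: connect_trans cxu (connect1 ruv).
(* [F L] is kept whole, so its border vertices outside [K] are neighbors of every new set and have
   to join [Z]. *)
pose C i := (F i :&: K) :|: F L.
pose Z' := Z :|: (border e Z (F L) :\: K).
have borderC i : i <= L -> border e Z' (C i) \subset border e Z (F i) :&: K.
  move=> iL; apply/subsetP => v /borderP[]; rewrite !in_setU !negb_or in_setD in_setI.
  move=> /andP[vZ vZ'] /andP[vFK vF] [u uC euv]; rewrite in_setI.
  have [uF|uF] := boolP (u \in F L).
    have vB := mem_border uF euv vF vZ.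
    move: vZ'; rewrite vB andbT negbK => vK; rewrite vK andbT; rewrite vK andbT in vFK.
    exact: mem_border (subsetP (FL i iL) u uF) euv vFK vZ.
  move: uC; rewrite in_setU in_setI (negPf uF) orbF => /andP[ui uK].
  have vK : v \in K.
    apply: Krel uK _; rewrite /r /region_rel /= euv uF vF.
    by rewrite (subsetP (F0 i iL) u ui).
  by rewrite vK andbT; rewrite vK andbT in vFK; apply: mem_border ui euv vFK vZ.
have CF i : i <= L -> C i \subset F i.
  by move=> iL; rewrite subUset subsetIl FL.
exists Z', C; split; first split.
- by move=> i iL; apply/setSU/setSI/FF.
- move=> z; rewrite !in_setU in_setI in_setD => /orP[zZ|/andP[zK zB]].
    have z0 := gap_disj gF zZ; rewrite (negPf z0) /=.
    by apply: contra z0; apply: (subsetP (F0 L _)).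
  by rewrite (negPf zK) andbF /=; case/borderP: zB.
- move=> i iL; apply: subset_trans (borderC _ iL) _; apply: subset_trans (subsetUl _ _).
  by apply: setSI; apply: nest_border nF _ iL.
- move=> z v zZ' v0; rewrite in_setU negb_or => /andP[_ vL].
  have v0' := subsetP (CF 0 isT) v v0.
  move: zZ'; rewrite in_setU in_setD => /orP[zZ|/andP[zK zB]].
    exact: gap_far gF _ _ zZ v0' vL.
  move: v0; rewrite in_setU in_setI (negPf vL) orbF => /andP[_ vK].
  apply: contra zK => ezv; apply: Krel vK _; have [_ zL _] := borderP zB.
  by rewrite /r /region_rel /= sym_e ezv v0' vL zL.
- move=> X LX X0; have [s [t [sB tB cs ct]]] := cpath x xR.
  rewrite -/r in cs ct; have tK : t \in K by rewrite KE.
  have [tZ tL [u uL eut]] := borderP tB.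
  have uX : u \in X by apply: (subsetP LX); rewrite in_setU uL orbT.
  have Z'K v : v \notin Z -> v \in K -> v \notin Z'.
    by move=> vZ vK; rewrite in_setU in_setD (negPf vZ) vK.
  apply/set0Pn; have [tX|tX] := boolP (t \in X); last first.
    by exists t; apply: mem_border uX eut tX (Z'K t tZ tK).
  have XF : X \subset F 0 := subset_trans X0 (CF 0 isT).
  have sX : s \notin X by have [_ sF _] := borderP sB; apply: contra sF; apply: (subsetP XF).
  have cts : connect r t s by apply: connect_trans cs; rewrite symr.
  have [a [b [cta aX bX rab]]] := connect_exit tX sX cts.
  have aK : a \in K by rewrite KE (connect_trans ct).
  have bK := Krel _ _ aK rab; have /and4P[eab _ _ _] := rab.
  by exists b; apply: mem_border aX eab bX (Z'K b (KZ b bK) bK).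
- move=> i iL; apply: leq_trans (subset_leq_card (borderC i iL)) _.
  rewrite -ltnS; apply: leq_trans (ck i iL); apply: proper_card.
  (* The component of [y] meets each border outside [K]. For i = L this comes from [component_path],
     since [component_meets] needs the border of [F L] inside the set. *)
  have [v vB cyv] : exists2 v, v \in border e Z (F i) & connect r y v.
    have [iL'|iL'] := ltnP i L.
      apply: cmeet => //; [exact: FL|exact: F0|].
      by have [_ _ ? _] := nest_gap nF iL' (leqnn L).
    have -> : i = L by apply/eqP; rewrite eqn_leq iL.
    by have [s [t [_ tB _ cyt]]] := cpath y yR; exists t.
  apply/properP; split; first exact: subsetIl.
  exists v => //; rewrite in_setI vB KE; apply: contra ncxy => cxv.
  by apply: connect_trans cxv _; rewrite symr.
Qed.

(* Bad gaps, which admit a set of smaller border, are used to build a nest with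
   smaller borders. *)
Lemma bad_gaps_nest Z n L C k : 0 < n -> nest e Z (n * L.+1.*2) C ->
  (forall b, b < L.+1.*2 -> exists2 i, i < n & exists X,
     [/\ C (n * b + i).+1 \subset X, X \subset C (n * b + i) & #|border e Z X| <= k]) ->
  exists X : nat -> {set T}, nest e Z L X /\ forall i, i <= L -> #|border e Z (X i)| <= k.
Proof.
move=> n0 nC bad.
(* Only the even blocks are used: the skipped ones keep consecutive choices at least two indices
   apart, which brings the border of [X i.+1] into [X i]. *)
have hX (b : 'I_L.+1) : exists p : nat * {set T}, [/\ p.1 < n, C (n * b.*2 + p.1).+1 \subset p.2,
    p.2 \subset C (n * b.*2 + p.1) & #|border e Z p.2| <= k].
  have [|i iN [X [? ? ?]]] := bad b.*2; first by rewrite ltn_double.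
  by exists (i, X).
have [h hP] := fin_all_exists hX.
pose g i := n * i.*2 + (h (inord i)).1; pose X i := (h (inord i)).2.
have gP i : i <= L -> [/\ (h (inord i)).1 < n, C (g i).+1 \subset X i, X i \subset C (g i) &
    #|border e Z (X i)| <= k].
  by move=> iL; have := hP (inord i); rewrite /g inordK.
have gB i : i <= L -> (g i).+2 <= n * i.+1.*2.
  by move=> /gP[+ _ _ _]; rewrite /g doubleS !mulnS; lia.
have gg i : i < L -> (g i).+2 <= g i.+1.
  by move=> iL; apply: leq_trans (gB i (ltnW iL)) (leq_addr _ _).
have gL i : i <= L -> (g i).+1 <= n * L.+1.*2.
  move=> iL; apply: ltnW; apply: leq_trans (gB i iL) _.
  by rewrite leq_mul2l leq_double ltnS iL orbT.
have CC i j : i <= j -> j <= n * L.+1.*2 -> C j \subset C i.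
  rewrite leq_eqVlt => /orP[/eqP-> //|ij jm]; by case: (nest_gap nC ij jm).
have X0 : X 0 \subset C 0.
  have [_ _ X0 _] := gP 0 isT; apply: subset_trans X0 (CC _ _ _ _) => //.
  exact: ltnW (gL 0 isT).
have XL : C (n * L.+1.*2) \subset X L.
  have [_ XL _ _] := gP L (leqnn L); apply: subset_trans _ XL; apply: CC => //.
  exact: gL.
exists X; split=> [|i /gP[]//]; have [_ disj _ far lnk] := nC; split.
- move=> i iL; have [_ Ci _ _] := gP i (ltnW iL); have [_ _ Xi _] := gP i.+1 iL.
  apply: subset_trans (subset_trans Xi _) Ci; apply: CC; last exact: ltnW (gL _ iL).
  exact: ltnW (gg i iL).
- by move=> z /disj; apply/contra/(subsetP X0).
- move=> i iL; have [_ Ci _ _] := gP i (ltnW iL); have [_ _ Xi _] := gP i.+1 iL.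
  have gi : (g i).+2 <= n * L.+1.*2 by apply: leq_trans (gg i iL) (ltnW (gL _ iL)).
  have Xi2 : X i.+1 \subset C (g i).+2.
    by apply: subset_trans Xi (CC _ _ (gg i iL) (ltnW (gL _ iL))).
  apply/subsetP => v /borderP[vZ _ [u uX euv]]; apply: (subsetP Ci).
  have [v2|v2] := boolP (v \in C (g i).+2); first by apply: (subsetP (CC _ _ _ gi)) v2.
  apply: (subsetP (nest_border nC _)) => //.
  exact: mem_border (subsetP Xi2 u uX) euv v2 vZ.
- move=> z v zZ v0 vL; apply: far zZ _ _; first exact: (subsetP X0).
  by apply: contra vL; apply: (subsetP XL).
- by move=> Y LY Y0; apply: lnk; [apply: subset_trans XL LY|apply: subset_trans Y0 X0].
Qed.

(** With L the value for [k'], 2(L + 1) blocks of n gaps let [bad_gaps_nest] build a nest of length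
    L, and each gap spans L steps, so that a disconnected one is itself a nest of length L. *)
Fixpoint nest_len n k := if k is k'.+1 then
  nest_len n k' * (n * (nest_len n k').+1.*2) else 1.

Lemma nest_len_gt0 n k : 0 < n -> 0 < nest_len n k.
Proof. by move=> n0; elim: k => //= k IH; rewrite !muln_gt0 IH n0. Qed.

Lemma connected_linked_nest n k Z C m : 0 < n -> m = nest_len n k ->
  nest e Z m C -> (forall i, i <= m -> #|border e Z (C i)| <= k) ->
  exists k' Z' (D : nat -> {set T}), [/\ 0 < k' <= k, nest e Z' n D,
    forall i, i <= n -> #|border e Z' (D i)| = k',
    forall i, i < n -> linked (region_rel e (D i) (D i.+1))
                         (border e Z' (D i)) (border e Z' (D i.+1)) k' &
    forall i, i < n -> forall x y, x \in region e Z' (D i) (D i.+1) ->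
      y \in region e Z' (D i) (D i.+1) -> connect (region_rel e (D i) (D i.+1)) x y].
Proof.
move=> n0; elim: k Z C m => [|k IH] Z C m -> /= nC ck.
  (* For k = 0 all borders are empty, against [nest_link]. *)
  have := nest_link nC (subxx _) (nest_dec nC (isT : 0 < 1)).
  by rewrite -card_gt0 ltnNge ck.
move: (nest_len n k) (nest_len_gt0 k n0) (IH) nC ck => L L0 {}IH nC ck.
have {}IH Z' C' : nest e Z' L C' -> (forall i, i <= L -> #|border e Z' (C' i)| <= k) ->
    exists k' Z' (D : nat -> {set T}), [/\ 0 < k' <= k.+1, nest e Z' n D,
    forall i, i <= n -> #|border e Z' (D i)| = k',
    forall i, i < n -> linked (region_rel e (D i) (D i.+1))
                         (border e Z' (D i)) (border e Z' (D i.+1)) k' &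
    forall i, i < n -> forall x y, x \in region e Z' (D i) (D i.+1) ->
      y \in region e Z' (D i) (D i.+1) -> connect (region_rel e (D i) (D i.+1)) x y].
  move=> nC' ck'; have [k' [Z2 [D [/andP[k0 kk] ? ? ? ?]]]] := IH Z' C' L erefl nC' ck'.
  by exists k', Z2, D; split=> //; rewrite k0 ltnW.
pose D i := C (L * i).
have nD : nest e Z (n * L.+1.*2) D.
  by apply: (subnest (h := muln L)) nC _ _ => // i _; rewrite mulnS -[X in X < _]add0n ltn_add2r.
have cD i : i <= n * L.+1.*2 -> #|border e Z (D i)| <= k.+1.
  by move=> im; apply: ck; rewrite leq_mul2l im orbT.
case: (classic (forall b, b < L.+1.*2 -> exists2 i, i < n & exists X,
     [/\ D (n * b + i).+1 \subset X, X \subset D (n * b + i) & #|border e Z X| <= k])).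
  by move=> /(bad_gaps_nest n0 nD)[X [nX cX]]; apply: IH nX cX.
move=> /not_all_ex_not nb; have [b nbb] := nb.
have [bL good] := imply_to_and _ _ nbb.
pose F i := D (n * b + i).
have nbL i : i <= n -> n * b + i <= n * L.+1.*2.
  by move=> iN; apply: (@leq_trans (n * b.+1)); rewrite ?leq_mul2l ?bL ?orbT // mulnS addnC leq_add2r.
have nF : nest e Z n F.
  by apply: (subnest (h := addn (n * b))) nD _ _ => [i _|]; rewrite ?addnS // nbL.
have kF i X : i < n -> F i.+1 \subset X -> X \subset F i -> k.+1 <= #|border e Z X|.
  move=> iN FX XF; rewrite ltnNge; apply/negP => kX; apply: good; exists i => //.
  by exists X; split; rewrite // -addnS.
(* The lower bound applies to the members themselves, as ends of gaps; [F n] is the inner end of the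
   last gap. *)
have cF i : i <= n -> #|border e Z (F i)| = k.+1.
  move=> iN; apply/eqP; rewrite eqn_leq cD ?nbL //=.
  have [iN'|ni] := ltnP i n; first exact: kF iN' (nest_dec nF iN') _.
  have -> : i = n.-1.+1 by lia.
  by apply: (kF n.-1); rewrite ?(nest_dec nF) ?prednK.
have gF i (iN : i < n) : gap e Z (F i) (F i.+1) := nest_gap nF (ltnSn i) iN.
have lF i : i < n -> linked (region_rel e (F i) (F i.+1))
                         (border e Z (F i)) (border e Z (F i.+1)) k.+1.
  by move=> iN; apply: gap_linked (gF i iN) _ _ => // X; apply: kF.
case: (classic (forall i, i < n -> forall x y, x \in region e Z (F i) (F i.+1) ->
      y \in region e Z (F i) (F i.+1) -> connect (region_rel e (F i) (F i.+1)) x y)).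
  by move=> conn; exists k.+1, Z, F; split; rewrite ?leqnn.
move=> /not_all_ex_not nc; have [i nci] := nc.
have {nci} [iN nci] := imply_to_and _ _ nci.
have [x ncx] := not_all_ex_not _ _ nci; have [y ncy] := not_all_ex_not _ _ ncx.
have [xR ncy'] := imply_to_and _ _ ncy; have [yR /negP ncxy] := imply_to_and _ _ ncy'.
(* The disconnected gap is refined to the L steps of the original nest that it spans. *)
pose G j := C (L * (n * b + i) + j).
have G0 : G 0 = F i by rewrite /G addn0.
have GL : G L = F i.+1 by rewrite /G /F /D addnS mulnS addnC.
have GB j : j <= L -> L * (n * b + i) + j <= L * (n * L.+1.*2).
  move=> jL; apply: (@leq_trans (L * (n * b + i.+1))).
    by rewrite addnS mulnS addnC leq_add2r.
  by rewrite leq_mul2l nbL ?orbT.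
have nG : nest e Z L G.
  by apply: (subnest (h := addn (L * (n * b + i)))) nC _ _ => [j _|]; rewrite ?addnS // GB.
have cG j : j <= L -> #|border e Z (G j)| <= k.+1 by move=> jL; apply: ck; apply: GB.
rewrite -G0 -GL in xR yR ncxy; have := lF i iN; rewrite -G0 -GL => lG.
have [||Z' [C' [nC' cC']]] := component_nest L0 nG lG _ _ cG xR yR ncxy.
- by rewrite G0 cF // ltnW.
- by rewrite GL cF.
exact: IH nC' cC'.
Qed.

End Reduction.

(** * The ring-decomposition *)

Lemma last_true (P : nat -> bool) n :
  P 0 -> ~~ P n -> exists2 i, i < n & P i && ~~ P i.+1.
Proof.
move=> P0; elim: n => [|m IH]; first by rewrite P0.
move=> Pm1; have [Pm|Pm] := boolP (P m); first by exists m; rewrite ?Pm.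
by have [i im Pi] := IH Pm; exists i => //; apply: ltnW.
Qed.

Section Ring.
Variable G : graph.
Local Notation e := (adj_in [set: gE G]).

Lemma adj_inP (ES : {set gE G}) x y : reflect
  (exists2 f, f \in ES & (src f = x /\ tgt f = y) \/ (src f = y /\ tgt f = x)) (adj_in ES x y).
Proof.
apply: (iffP exists_inP) => -[f fE].
  by case/orP=> /andP[/eqP sf /eqP tf]; exists f => //; [left|right].
by move=> xy; exists f => //; case: xy => -[-> ->]; rewrite !eqxx ?orbT.
Qed.

Lemma adj_in_sym (ES : {set gE G}) : symmetric (adj_in ES).
Proof. by move=> x y; apply: eq_existsb => f; rewrite orbC. Qed.

Lemma edge_adj (f : gE G) : e (src f) (tgt f).
Proof. by apply/adj_inP; exists f => //; left. Qed.

Lemma card_adj_deg v : #|[set u | e v u]| <= deg v.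
Proof.
(* Parallel edges may lead to the same neighbor: [other] maps the incident edges onto the
   neighbors. *)
pose other f := if src f == v then tgt f else src f.
apply: leq_trans (leq_imset_card other _); apply/subset_leq_card/subsetP => u.
rewrite inE => /adj_inP[f _ [[sv tu]|[su tv]]]; apply/imsetP; exists f.
- by rewrite inE sv eqxx.
- by rewrite /other sv eqxx.
- by rewrite inE tv eqxx orbT.
- by rewrite /other -tv eq_sym su; have := loopless f; rewrite su eq_sym => /negPf->.
Qed.

Lemma graph_cut_connected : graph_connected G -> cut_connected e [set: gV G].
Proof.
move=> [V0 conn]; split=> // X /properP[_ [z _ zX]] /set0Pn[x xX].
have [a [b [_ aX bX eab]]] := connect_exit xX zX (conn x z (in_setT x) (in_setT z)).
by exists a, b.
Qed.

Definition meets (D : {set gV G}) f := (src f \in D) || (tgt f \in D).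

Variables (Z : {set gV G}) (n k : nat) (D : nat -> {set gV G}).
Hypothesis n3 : 2 < n.
Hypothesis nD : nest e Z n D.
Local Notation B i := (border e Z (D i)).

(** [Z] lies outside [D 0], so the piece of index 0 absorbs it together with all its edges to [D n];
    this piece closes the ring. *)
Definition ring_vertices i : {set gV G} :=
  if i is j.+1 then region e Z (D j) (D j.+1) else ~: D 0 :|: (D n :|: B n).

(** The sets [D i] decrease, so an edge is sorted by the last of them that it meets; edges that miss
    [D 0] or still meet [D n] go to the closing piece. *)
Definition ring_edges i : {set gE G} :=
  if i is j.+1 then [set f | meets (D j) f && ~~ meets (D j.+1) f]
  else [set f | ~~ meets (D 0) f || meets (D n) f].

Lemma ring_adj i : adj_in (ring_edges i.+1) =2 region_rel e (D i) (D i.+1).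
Proof.
move=> x y; apply/adj_inP/and4P => [[f + xy]|[exy xyi xi yi]].
  rewrite inE /meets negb_or.
  by case: xy => -[<- <-] /andP[fi /andP[? ?]]; split=> //;
    rewrite ?[e (tgt f) _]adj_in_sym ?edge_adj // orbC.
have [f _ xy] := adj_inP _ _ _ exy; exists f => //.
by case: xy => -[sx tx]; rewrite inE /meets sx tx negb_or xi yi ?andbT // orbC.
Qed.

Let sub i j : i <= j -> j <= n -> D j \subset D i.
Proof.
rewrite leq_eqVlt => /orP[/eqP->//|ij jn].
by have [] := nest_gap nD ij jn.
Qed.

Let bsub i j : i < j -> j <= n -> B j \subset D i.
Proof. by move=> ij jn; have [] := nest_gap nD ij jn. Qed.

Let bnot i v : v \in B i -> v \notin D i.
Proof. by case/borderP. Qed.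

(** A vertex of the later piece lies in [D i], hence not in its border, and it lies in [D i.+1] as
    well unless it is in the border of [D j] with j = i + 1. *)
Lemma ring_vertices_pos i j v : i < j -> j < n ->
  v \in ring_vertices i.+1 -> v \in ring_vertices j.+1 -> j = i.+1 /\ v \in B j.
Proof.
move=> ij jn /setUP vi /setUP[vj|/setDP[vj _]].
  have vi' := subsetP (bsub ij (ltnW jn)) v vj.
  case: vi => [/bnot|/setDP[_ vi]]; first by rewrite vi'.
  split=> //; apply/eqP; rewrite eqn_leq ij andbT leqNgt; apply: contra vi => ij'.
  exact: (subsetP (bsub ij' (ltnW jn))) vj.
have vi' := subsetP (sub (ltnW ij) (ltnW jn)) v vj.
case: vi => [/bnot|/setDP[_]]; first by rewrite vi'.
by rewrite (subsetP (sub ij (ltnW jn)) v vj).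
Qed.

Lemma ring_vertices_0 i v : i < n -> v \in ring_vertices 0 -> v \in ring_vertices i.+1 ->
  (i = 0 /\ v \in B 0) \/ (i.+1 = n /\ v \in B n).
Proof.
move=> iN + /setUP vi; rewrite inE => /orP[|/setUP[vn|vn]].
- rewrite inE => v0; left; have vi' : v \notin D i.
    by apply: contra v0; apply: (subsetP (sub (leq0n i) (ltnW iN))).
  case: vi => [vi|/setDP[vi _]]; last by rewrite vi in vi'.
  case: i iN vi {vi'} => // i iN vi.
  by rewrite (subsetP (bsub (ltn0Sn i) (ltnW iN)) v vi) in v0.
- have vi' := subsetP (sub (ltnW iN) (leqnn n)) v vn.
  case: vi => [/bnot|/setDP[_]]; first by rewrite vi'.
  by rewrite (subsetP (sub iN (leqnn n)) v vn).
- have vi' := subsetP (bsub iN (leqnn n)) v vn.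
  case: vi => [/bnot|/setDP[_ vi]]; first by rewrite vi'.
  right; split=> //; apply/eqP; rewrite eqn_leq iN leqNgt; apply: contra vi => iN'.
  exact: (subsetP (bsub iN' (leqnn n))) vn.
Qed.

Lemma ring_Wset i : i <= n -> Wset n ring_vertices i.+1 = B i.
Proof.
have [m nm] : exists m, n = m.+1 by exists n.-1; rewrite prednK // ltnW // ltnW.
have mn : m < n by rewrite nm.
rewrite leq_eqVlt => /orP[/eqP->|iN]; apply/setP => v; rewrite /Wset in_setI [_.+1.-1]/=.
  rewrite modnn; apply/andP/idP => [[vn v0]|vn].
    rewrite [in ring_vertices _]nm in vn.
    by have [[m0 _]|[]] := ring_vertices_0 mn v0 vn => //; move: n3; rewrite nm m0.
  split; last by rewrite !in_setU vn !orbT.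
  rewrite [in ring_vertices _]nm in_setU in_setD -nm (bnot vn).
  by rewrite (subsetP (bsub mn (leqnn n)) v vn) orbT.
rewrite modn_small //; apply/andP/idP => [|vi].
  case: i iN => [|i] iN [vi vj].
    by have [[_]|[n1 _]] := ring_vertices_0 iN vi vj => //; move: n3; rewrite -n1.
  by case: (ring_vertices_pos (ltnSn i) iN vi vj).
split; last by rewrite in_setU vi.
case: i iN vi => [|i] iN vi; first by rewrite in_setU in_setC (bnot vi).
by rewrite in_setU in_setD (bnot vi) (subsetP (bsub (ltnSn i) (ltnW iN)) v vi) orbT.
Qed.

Lemma ring_edge_disjoint i j : i < j -> j <= n -> ring_edges i :&: ring_edges j = set0.
Proof.
case: j => // j ij jn; apply/setP => f; rewrite !in_setI in_set0; apply/negP => /andP[+].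
have mm a b : a <= b -> b <= n -> meets (D b) f -> meets (D a) f.
  by move=> ab bn /orP[] /(subsetP (sub ab bn)) fa; rewrite /meets fa ?orbT.
rewrite [_ \in ring_edges j.+1]inE => + /andP[fj fj'].
case: i ij => [|i] ij; rewrite inE.
  case/orP=> [|fn]; first by rewrite (mm _ _ _ _ fj) // ltnW.
  by rewrite (mm _ _ jn _ fn) in fj'.
by case/andP=> _; rewrite (mm _ _ _ _ fj) // ltnW.
Qed.

Lemma nest_ring : 0 < k -> (forall i, i <= n -> #|B i| = k) ->
  (forall i, i < n -> linked (region_rel e (D i) (D i.+1)) (B i) (B i.+1) k) ->
  (forall i, i < n -> forall x y, x \in region e Z (D i) (D i.+1) ->
      y \in region e Z (D i) (D i.+1) -> connect (region_rel e (D i) (D i.+1)) x y) ->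
  connected_ring_decomposition k n ring_vertices ring_edges.
Proof.
move=> k0 cB lB conn.
have gD i : i < n -> gap e Z (D i) (D i.+1) by move=> iN; apply: nest_gap nD _ iN.
have syme := @adj_in_sym [set: gE G].
split; last first.
  case=> // i iN; split.
    have /set0Pn[v vB] : B i != set0 by rewrite -card_gt0 cB // ltnW.
    by apply/set0Pn; exists v; rewrite inE vB.
  by move=> x y xR yR; rewrite (eq_connect (ring_adj i)) conn.
have nedisj i j : i < j -> j <= n -> ~~ consecutive n i j ->
    ring_vertices i :&: ring_vertices j = set0.
  move=> ij jn ncij; apply/setP => v; rewrite in_setI in_set0; apply: contraNF ncij.
  case: j ij jn => // j ij jn /andP[vi vj]; rewrite /consecutive.
  case: i ij vi => [|i] ij vi.
    have [[-> _]|[-> _]] := ring_vertices_0 jn vi vj; last by rewrite modnn orbT.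
    by rewrite modn_small // ltnS ltnW // ltnW.
  have [ji _] := ring_vertices_pos (i := i) (j := j) ij jn vi vj.
  by rewrite ji in jn *; rewrite modn_small ?eqxx.
have csym i j : consecutive n i j = consecutive n j i by rewrite /consecutive orbC.
have cover (P : pred {set gV G}) : P (D 0) -> ~~ P (D n) ->
    exists2 i, i < n & P (D i) && ~~ P (D i.+1).
  exact: (@last_true (fun i => P (D i)) n).
split=> //; split=> //; split; last split; last split; last split; last split.
- move=> [|i] iN f.
    (* If [u] is in [D 0] but not in [D n], then [v] is in [D n], and [u] is in the border of [D n]
       because [Z] misses [D 0]. *)
    have end0 u v : e u v -> (u \notin D 0) || (u \in D n) || (v \in D n) -> u \in ring_vertices 0.
      move=> euv; rewrite !in_setU in_setC; have [u0|//] /= := boolP (u \in D 0).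
      have [//|un] /= := boolP (u \in D n) => vn.
      rewrite (mem_border vn _ un) //; first by rewrite syme.
      by apply: contraL u0 => /(nest_disj nD).
    have efu := edge_adj f; have efv : e (tgt f) (src f) by rewrite syme.
    rewrite inE /meets negb_or => H; apply/andP; split.
      by apply: end0 efu _; move: H => /orP[/andP[->]|/orP[]->]; rewrite ?orbT.
    by apply: end0 efv _; move: H => /orP[/andP[_ ->]|/orP[]->]; rewrite ?orbT.
  move=> fi; have rf : adj_in (ring_edges i.+1) (src f) (tgt f).
    by apply/adj_inP; exists f => //; left.
  rewrite ring_adj in rf; rewrite (region_rel_region syme (gD i iN) rf) andbT.
  by apply: (region_rel_region syme (gD i iN) (a := tgt f)); rewrite (region_rel_sym syme).
- apply/setP => v; rewrite in_setT; apply/bigcupP.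
  have [v0|v0] := boolP (v \in ring_vertices 0); first by exists ord0.
  move: v0; rewrite !in_setU in_setC !negb_or negbK => /and3P[v0 vn _].
  have [i iN vi] := cover (fun X => v \in X) v0 vn.
  by exists (Ordinal (iN : i.+1 < n.+1)); rewrite // in_setU in_setD andbC vi orbT.
- apply/setP => f; rewrite in_setT; apply/bigcupP.
  have [f0|f0] := boolP (f \in ring_edges 0); first by exists ord0.
  move: f0; rewrite inE negb_or negbK => /andP[f0 fn].
  have [i iN fi] := cover (fun X => meets X f) f0 fn.
  by exists (Ordinal (iN : i.+1 < n.+1)); rewrite // inE fi.
- move=> i j iN jN; rewrite neq_ltn => /orP[ij|ji].
    by split=> [_|]; [apply: ring_edge_disjoint|apply: nedisj].
  rewrite csym setIC [ring_vertices i :&: _]setIC.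
  by split=> [_|]; [apply: ring_edge_disjoint|apply: nedisj].
- by case=> // i iN; rewrite ring_Wset ?cB.
- case=> // i iN; rewrite !ring_Wset ?(ltnW iN) //.
  have [ps [psP psD]] := lB i iN; exists ps; split=> // j.
  have [sB tB pp up] := psP j; split=> //.
    by rewrite (eq_path (ring_adj i)).
  apply/allP => v vp; apply: (region_connect syme (gD i iN) (a := (ps j).1)).
    by rewrite in_setU sB.
  move: vp; rewrite inE => /orP[/eqP->|vp]; first exact: connect0.
  by apply: (path_connect pp); rewrite inE vp orbT.
Qed.

End Ring.

Theorem theorem6p1 :
  exists f : nat -> nat -> nat -> nat,
    forall n w d : nat, 3 <= n -> 0 < w -> 0 < d ->
    forall G : graph,
      graph_connected G ->
      treewidth_le G w ->
      (forall v : gV G, deg v <= d) ->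
      f n w d <= #|gV G| ->
      exists (w' n' : nat) (GV : nat -> {set gV G}) (GE : nat -> {set gE G}),
        [/\ w' <= w, n <= n' & connected_ring_decomposition w' n' GV GE].
Proof.
(* This is the chain length from which [exists_nest] extracts a nest of length [nest_len n w], as
   [connected_linked_nest] requires for borders of size at most w. *)
pose len n w d := ((nest_len n w).+1 * (w * d).+1) ^ w.+1.
exists (fun n w d => (chain_bound w d (len n w d)).+1).
move=> n w d n3 _ _ G conn [k [tr [bag [[tree bagv bage bagt] cbag]]]] degG bigG.
have cutG := graph_cut_connected conn; set e := adj_in _ in cutG.
have syme : symmetric e := adj_in_sym _.
have dege v : #|[set u | e v u]| <= d := leq_trans (card_adj_deg v) (degG v).
have bagE u v : e u v -> exists t, (u \in bag t) && (v \in bag t).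
  case/adj_inP=> f _ [[<- <-]|[<- <-]]; first exact: bage.
  by have [t tf] := bage f; exists t; rewrite andbC.
have step := bag_step tree bagv bagE bagt.
have [k0 _ _ _ _] := tree.
(* The chain starts at the whole vertex set, whose neighborhood is empty, so any node serves as the
   first one. *)
have NT : nbhd e [set: gV G] \subset bag (Ordinal k0).
  by apply/subsetP => v /nbhdP[]; rewrite in_setT.
have bigT : chain_bound w d (len n w d) < #|[set: gV G]| by rewrite cardsT.
have [c [_ cc]] := long_chain syme dege cbag step cutG cutG NT bigT.
have [Z [C [nC cC]]] := exists_nest dege erefl cc.
have [k' [Z' [D [/andP[k'0 k'w] nD cD lD conD]]]] :=
  connected_linked_nest syme cutG (ltnW (ltnW n3)) erefl nC cC.
exists k', n, (ring_vertices Z' n D), (ring_edges n D); split=> //.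
exact: nest_ring.
Qed.
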